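(* Let $(X,d)$ be a compact metric space and let $A$ be a bounded subset of $C(X)$ with the sup norm. Then $A$ is Bourbaki quasi-precompact in itself if and only if $A$ is equi-chain continuous.
   Context: $C(X)$ is the space of real valued continuous functions on $X$ with the sup norm metric. For a metric space $(M,\mu)$ and $\varepsilon>0$, an $\varepsilon$-chain from $u$ to $v$ in $M$ is a finite ordered set of points $u=u_0,u_1,\dots,u_n=v$ of $M$ with $\mu(u_{i-1},u_i)<\varepsilon$ for $i=1,\dots,n$. For $p\in M$, $B^\infty_\varepsilon(p)$ denotes the set of points of $M$ that can be joined to $p$ by an $\varepsilon$-chain in $M$. $M$ is Bourbaki quasi-precompact if for every $\varepsilon>0$ there are finitely many points $p_1,\dots,p_k\in M$ with $M=\bigcup_{i=1}^kB^\infty_\varepsilon(p_i)$. A subset $A$ of a metric space is Bourbaki quasi-precompact in itself if $A$, with the induced metric, is a Bourbaki quasi-precompact metric space (all chains and centres lie in $A$). A subset $A\subseteq C(X)$ is equi-chain continuous if for each $\varepsilon>0$ there exist numbers $\delta_x>0$ ($x\in X$) such that for each $f\in A$ there is $g_f^\varepsilon\in A$ (depending on $f$ and $\varepsilon$ but not on $x$) with the following properties: $f$ and $g_f^{\varepsilon}$ can be joined by an $\varepsilon$-chain in $A$, and for all $x,y\in X$, $d(x,y)<\delta_x$ implies $|g_f^\varepsilon(x)-g_f^\varepsilon(y)|<\varepsilon$. *)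

(* Defs.v *)
From HB Require Import structures.
From mathcomp Require Import all_boot all_order all_algebra.
From mathcomp Require Import all_classical all_reals all_analysis.

Set Implicit Arguments.
Unset Strict Implicit.
Unset Printing Implicit Defensive.

Import Order.TTheory GRing.Theory Num.Theory.
Import numFieldNormedType.Exports.

Local Open Scope classical_set_scope.
Local Open Scope ring_scope.

Section Bourbaki.
Context {R : realType} {M : metricType R}.
Implicit Types (A : set M) (e : R) (p q : M).

(* All the notions below are those of the metric space A with the metric
   induced by M; A = setT gives the corresponding notions for M itself. *)

Definition chained A e p q : Prop :=
  exists (n : nat) (u : nat -> M),
    [/\ u 0%N = p, u n = q,
        forall i, (i <= n)%N -> A (u i) &
        forall i, (i < n)%N -> mdist (u i) (u i.+1) < e].

Definition chain_ball A e p : set M := [set q | chained A e p q].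

(* F may be empty, so that the empty set is Bourbaki quasi-precompact. *)
Definition Bourbaki_quasi_precompact A : Prop :=
  forall e, 0 < e -> exists F : set M,
    [/\ finite_set F, F `<=` A & A = \bigcup_(p in F) chain_ball A e p].

End Bourbaki.

Definition sup_norm {R : realType} {X : Type} (f : X -> R) : R :=
  sup (range (fun x => `|f x|)).

(* The space of real continuous functions on X. The compactness of X is a
   parameter because the sup norm defines a metric only on bounded functions. *)
Definition contfun {R : realType} {X : metricType R} (cX : compact [set: X]) :
  Type := continuousType X R.

Section ContFun.
Context {R : realType} {X : metricType R} (cX : compact [set: X]).
Implicit Types f g h : contfun cX.

HB.instance Definition _ := Choice.on (contfun cX).

Definition sup_dist f g : R := sup_norm (fun x => f x - g x).

Lemma sup_dist_has_ubound f g : has_ubound (range (fun x => `|f x - g x|)).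
Proof.
have cfg : continuous (fun x : X => f x - g x).
  by move=> x; apply: continuousB; exact: cts_fun.
have cK : compact ((fun x : X => f x - g x) @` [set: X]).
  by apply: continuous_compact; [exact: continuous_subspaceT | exact: cX].
have [M [_ fgM]] := compact_bounded cK.
by exists (M + 1) => _ [x _ <-]; apply: (fgM (M + 1)); [rewrite ltrDl | exists x].
Qed.

Lemma le_sup_dist f g x : `|f x - g x| <= sup_dist f g.
Proof. by apply: ub_le_sup; [exact: sup_dist_has_ubound | exists x]. Qed.

Lemma sup_dist_le f g (c : R) :
  0 <= c -> (forall x, `|f x - g x| <= c) -> sup_dist f g <= c.
Proof.
move=> c0 fgc; rewrite /sup_dist /sup_norm.
have [->|/set0P fg0] := eqVneq (range (fun x => `|f x - g x|)) set0.
  by rewrite sup0.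
by apply: ge_sup => // _ [x _ <-].
Qed.

Lemma sup_dist_ge0 f g : 0 <= sup_dist f g.
Proof.
rewrite /sup_dist /sup_norm.
have [->|/set0P[_ [x _ _]]] := eqVneq (range (fun x => `|f x - g x|)) set0.
  by rewrite sup0.
exact: le_trans (le_sup_dist f g x).
Qed.

Lemma sup_distxx f : sup_dist f f = 0.
Proof.
apply/eqP; rewrite eq_le sup_dist_ge0 andbT; apply: sup_dist_le => // x.
by rewrite subrr normr0.
Qed.

Lemma sup_dist_positivity f g : sup_dist f g = 0 -> f = g.
Proof.
move=> fg0; apply/continuousEP => x; apply/eqP.
by rewrite -subr_eq0 -normr_le0 -fg0 le_sup_dist.
Qed.

Lemma sup_dist_sym f g : sup_dist f g = sup_dist g f.
Proof.
suff le_dist f' g' : sup_dist f' g' <= sup_dist g' f'.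
  by apply/eqP; rewrite eq_le !le_dist.
by apply: sup_dist_le => [|x]; rewrite ?sup_dist_ge0// distrC le_sup_dist.
Qed.

Lemma sup_dist_triangle g f h :
  sup_dist f h <= sup_dist f g + sup_dist g h.
Proof.
apply: sup_dist_le => [|x]; first by rewrite addr_ge0 ?sup_dist_ge0.
by rewrite (le_trans (ler_distD (g x) _ _))// lerD ?le_sup_dist.
Qed.

HB.instance Definition _ := isMetric.Build R (contfun cX)
  sup_distxx sup_dist_positivity sup_dist_sym sup_dist_triangle.

Implicit Type A : set (contfun cX).

Definition sup_bounded A : Prop :=
  exists K : R, forall f, A f -> sup_norm f <= K.

Definition equi_chain_continuous A : Prop :=
  forall e : R, 0 < e ->
  exists delta : X -> R, (forall x, 0 < delta x) /\
    forall f, A f -> exists g : contfun cX,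
      [/\ A g, chained A e f g &
          forall x y, mdist x y < delta x -> `|g x - g y| < e].

End ContFun.

(* Main.v *)
(* If A is covered by finitely many e-chain balls, take for g_f the centre of a
   ball containing f: finitely many continuous functions have a common modulus
   at each point. Conversely, the functions g_f for e/4 are uniformly bounded
   and share the moduli delta. Compactness gives finitely many points x_i whose
   balls of radius delta x_i cover X; two such g agreeing up to e/4 at every x_i
   are at sup distance at most 3e/4, and bounded vectors of values (g(x_i))_i
   fall into finitely many classes of diameter < e/4. A representative of the
   class of g_f is therefore one step away from the chain joining f to g_f. *)
Require Import Defs.
From mathcomp Require Import all_boot all_order all_algebra.
From mathcomp Require Import all_classical all_reals all_analysis.
From mathcomp Require Import finmap lra.

Import Order.TTheory GRing.Theory Num.Theory.
Import numFieldNormedType.Exports.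

Local Open Scope classical_set_scope.
Local Open Scope ring_scope.

Lemma finite_fiber_representatives {T : choiceType} {I : finType}
    (phi : T -> I) (G : set T) :
  exists F : set T, [/\ finite_set F, F `<=` G &
    forall g, G g -> exists2 h, F h & phi h = phi g].
Proof.
have [->|/set0P[g0 _]] := eqVneq G set0.
  by exists set0; split=> //; exact: finite_set0.
pose r i := xget g0 (G `&` phi @^-1` [set i]).
have rP g : G g -> G (r (phi g)) /\ phi (r (phi g)) = phi g.
  move=> Gg; have [] // := @xgetPex _ g0 (G `&` phi @^-1` [set phi g]).
  by exists g.
exists (r @` (phi @` G)); split.
- apply: finite_image; exact: finite_finset.
- by move=> _ [_ [g Gg <-] <-]; have [] := rP _ Gg.
- move=> g Gg; exists (r (phi g)); last by have [] := rP _ Gg.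
  by exists (phi g) => //; exists g.
Qed.

(** Pigeonhole: [[-K, K]] is cut into half-open cells of length [e], and [g] is classified by the
    cells containing its values along [s]. *)
Lemma finite_net_on_seq {R : realType} {T : choiceType} {X : eqType}
    (v : T -> X -> R) (G : set T) (s : seq X) (K e : R) :
  0 < e -> (forall g, G g -> forall x, `|v g x| <= K) ->
  exists F : set T, [/\ finite_set F, F `<=` G &
    forall g, G g -> exists2 h, F h & forall x, x \in s -> `|v g x - v h x| < e].
Proof.
move=> e0 vK.
pose N := Num.truncn ((K + K) / e).
pose t g x := Num.truncn ((v g x + K) / e).
pose phi g : {ffun 'I_(size s) -> 'I_N.+1} :=
  [ffun i => inord (t g (tnth (in_tuple s) i))].
have [F [finF FG Frep]] := finite_fiber_representatives phi G.
exists F; split=> // g Gg; have [h Fh phihg] := Frep _ Gg.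
exists h => // _ /(tnthP (in_tuple s))[i ->].
move/ffunP: phihg => /(_ i); rewrite !ffunE.
set x := tnth _ i.
(* [inord] separates only indices below [N.+1]; the bound [v k x + K <= K + K] keeps every index in
   that range. *)
have tN k : G k -> (t k x < N.+1)%N.
  move=> Gk; rewrite ltnS; apply: le_truncn; rewrite ler_pM2r ?invr_gt0//.
  by rewrite lerD2r (le_trans (ler_norm _))// vK.
move=> /(congr1 val); rewrite /= !inordK ?tN//; last exact: FG.
have tP k : G k -> (t k x)%:R * e <= v k x + K < (t k x).+1%:R * e.
  move=> Gk; rewrite -ler_pdivlMr// -ltr_pdivrMr//; apply: truncn_itv.
  apply: divr_ge0; last exact: ltW.
  by have := vK _ Gk x; rewrite ler_norml; lra.
have := tP _ Gg; have := tP _ (FG _ Fh); move=> /[swap] + /[swap] ->.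
by rewrite -natr1 ltr_norml; lra.
Qed.

Lemma compact_mdist_seq_cover {R : realType} {X : metricType R}
    (cX : compact [set: X]) (delta : X -> R) :
  (forall x, 0 < delta x) ->
  exists s : seq X, forall x, exists2 y, y \in s & mdist y x < delta y.
Proof.
move=> delta0.
(* In this filter a property holds eventually when it holds for all lists containing some fixed
   list. Near-covering compactness along it yields one list that serves every point. *)
pose Fin : set_system (seq X) :=
  filter_from setT (fun s0 : seq X => [set s : seq X | {subset s0 <= s}]).
have FinF : Filter Fin.
  apply: filter_from_filter; first by exists [::].
  move=> a b _ _; exists (a ++ b) => // s /= sab.
  by split=> x xs; apply: sab; rewrite mem_cat xs ?orbT.
have [] := (compact_near_coveringP [set: X]).1 cX (seq X) Fin
  (fun s x => exists2 y, y \in s & mdist y x < delta y) FinF.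
  move=> x _.
  exists (ball x (delta x), [set s | x \in s]) => /=.
    split; first exact: nbhsx_ballx.
    by exists [:: x] => // s; apply; rewrite inE.
  by move=> [z s] [/=]; rewrite ballEmdist /= => xz xs; exists x.
by move=> s _ /(_ s (fun _ h => h)) cov; exists s => x; exact: cov.
Qed.

Section Chains.
Context {R : realType} {M : metricType R}.
Implicit Types (A : set M) (e : R) (p q r : M).

Lemma chained_endpoint A e p q : chained A e p q -> A q.
Proof. by move=> [n [u [_ <- uA _]]]; exact: uA. Qed.

Lemma chained_sym A e p q : chained A e p q -> chained A e q p.
Proof.
move=> [n [u [u0 un uA ue]]].
exists n, (fun i => u (n - i)%N); split.
- by rewrite subn0.
- by rewrite subnn.
- by move=> i _; apply: uA; exact: leq_subr.
- move=> i lin; rewrite metric_sym -(subnSK lin).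
  by apply: ue; rewrite subnSK// leq_subr.
Qed.

Lemma chained_le A e1 e2 p q : e1 <= e2 -> chained A e1 p q -> chained A e2 p q.
Proof.
move=> e12 [n [u [u0 un uA ue]]]; exists n, u; split=> // i lin.
exact: lt_le_trans (ue _ lin) e12.
Qed.

Lemma chained_step A e p q r :
  chained A e p q -> A r -> mdist q r < e -> chained A e p r.
Proof.
move=> [n [u [u0 un uA ue]]] Ar qr.
exists n.+1, (fun i => if (i <= n)%N then u i else r); split=> //.
- by rewrite ltnn.
- by move=> i _; case: ifP => [/uA|].
- move=> i; rewrite ltnS => lin; rewrite lin; case: ltnP => [|nlei].
    exact: ue.
  by rewrite (_ : i = n) ?un//; apply/eqP; rewrite eqn_leq lin.
Qed.

End Chains.

Lemma le_sup_norm {R : realType} {X : metricType R} {cX : compact [set: X]}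
    (f : contfun cX) x : `|f x| <= sup_norm f.
Proof.
have cK : compact (f @` [set: X]).
  apply: continuous_compact => //; apply: continuous_subspaceT; exact: cts_fun.
have [M [_ fM]] := compact_bounded cK.
apply: ub_le_sup; last by exists x.
by exists (M + 1) => _ [y _ <-]; apply: (fM (M + 1)); [rewrite ltrDl | exists y].
Qed.

Lemma finite_set_equicontinuous {R : realType} {X : metricType R}
    {cX : compact [set: X]} (F : set (contfun cX)) (e : R) (x : X) :
  finite_set F -> 0 < e ->
  exists2 d : R, 0 < d &
    forall g, F g -> forall y, mdist x y < d -> `|g x - g y| < e.
Proof.
move=> /finite_fsetP[D ->] e0.
have : nbhs x (\bigcap_(g in [set` D]) [set y | `|g x - g y| < e]).
  apply: filter_bigI => g _.
  have cg : g @ x --> g x by exact: cts_fun.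
  by move/cvgrPdist_lt: cg; apply.
move=> /nbhs_ballP[d /= d0 xd]; exists d => // g Dg y xy.
by apply: (xd y) => //; rewrite ballEmdist.
Qed.

Theorem theorem2p8 (R : realType) (X : metricType R) (cX : compact [set: X])
    (A : set (contfun cX)) (bA : sup_bounded A) :
  Bourbaki_quasi_precompact A <-> equi_chain_continuous A.
Proof.
split=> [qpA e e0|eccA e e0].
- have [F [finF FA AE]] := qpA e e0.
  have /choice[delta deltaP] : forall x, exists d : R, 0 < d /\
      forall g, F g -> forall y, mdist x y < d -> `|g x - g y| < e.
    move=> x.
    by have [d d0 dP] := finite_set_equicontinuous F e x finF e0; exists d.
  exists delta; split=> [x|f]; first by have [] := deltaP x.
  rewrite {1}AE => -[g Fg gf]; exists g; split; first exact: FA.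
    exact: chained_sym.
  by move=> x y; have [_] := deltaP x; exact.
- have [K AK] := bA.
  have e40 : 0 < e / 4 by lra.
  have [delta [delta0 deltaP]] := eccA _ e40.
  have [s sP] := compact_mdist_seq_cover cX _ delta0.
  (* The net is taken inside [G], not just [A], so that each representative [h] also has the moduli
     [delta]. *)
  pose G := [set g | A g /\
    forall x y, mdist x y < delta x -> `|g x - g y| < e / 4].
  have [F [finF FG Fnet]] : exists F : set (contfun cX),
      [/\ finite_set F, F `<=` G & forall g, G g ->
        exists2 h, F h & forall x, x \in s -> `|g x - h x| < e / 4].
    apply: (finite_net_on_seq (fun g : contfun cX => g : X -> R) G s K) => //.
    by move=> g [/AK gK _] x; exact: le_trans (le_sup_norm _ _) gK.
  have FA : F `<=` A by move=> g /FG[].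
  exists F; split=> //; apply/seteqP; split=> [f Af|f [g _]]; last first.
    exact: chained_endpoint.
  have [g [Ag fg gd]] := deltaP _ Af.
  have [h Fh gh] := Fnet g (conj Ag gd).
  (* The [e / 4]-chain from [f] to [g] is prolonged by the single step from [g] to [h], then
     reversed to start at the centre. *)
  exists h => //; apply: chained_sym; apply: (@chained_step _ _ _ _ _ g).
  + by apply: chained_le fg; lra.
  + exact: FA.
  (* Strict pointwise bounds give only a non-strict bound on the supremum; the slack between
     [3 / 4 * e] and [e] restores strictness. *)
  + suff : sup_dist g h <= 3 / 4 * e.
      by move=> H; apply: le_lt_trans H _; lra.
    apply: sup_dist_le => [|x]; first lra.
    (* The path from [g x] to [h x] passes through [g y] and [h y]; both moduli are used at the
       centre [y]. *)
    have [y ys yx] := sP x; have [_ hd] := FG _ Fh.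
    have := gh _ ys; have := gd _ _ yx; have := hd _ _ yx.
    by rewrite !ltr_norml ler_norml; lra.
Qed.
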